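(* Let $A$ be a finite alphabet with $|A| = a \ge 2$, let $n$ be a positive integer and $k$ an integer with $2 \le k \le n/2$. There does not exist a universal partial word for $A^n$ of the form $w = u\diamond^k v$, where $u$ and $v$ are (possibly empty) words over $A$ (containing no $\diamond$).
   Context: A partial word over $A$ is a finite sequence of characters from $A \cup \{\diamond\}$, where $\diamond \notin A$ is a wild-card symbol; a word over $A$ contains no $\diamond$. $A^n$ denotes the set of words of length $n$ over $A$. For $x = x_1\cdots x_n \in A^n$ and a partial word $w = w_1\cdots w_N$, the position $i$ ($0 \le i \le N-n$) covers $x$ if $x_j = w_{i+j}$ for every $1\le j\le n$ with $w_{i+j}\in A$. A universal partial word for $A^n$ is a partial word $w$ such that every word in $A^n$ is covered by exactly one position of $w$. $\diamond^k$ denotes $k$ consecutive $\diamond$'s. *)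

(* Defs.v *)
From mathcomp Require Export all_boot.

Set Implicit Arguments.
Unset Strict Implicit.
Unset Printing Implicit Defensive.

(* [None] is the wild-card symbol. *)
Definition pword (A : Type) : Type := seq (option A).

Definition pword_of_word (A : Type) (u : seq A) : pword A := map Some u.

Definition diamonds (A : Type) (k : nat) : pword A := nseq k None.

(* The range 0 <= i <= N - n is written i + n <= N, because natural subtraction
   truncates: if N < n there is no position at all. Letters are numbered
   from 0. *)
Definition covers (A : Type) (n : nat) (w : pword A) (i : nat)
    (x : n.-tuple A) : Prop :=
  i + n <= size w /\
  forall (j : 'I_n) (c : A), nth None w (i + j) = Some c -> tnth x j = c.

Definition universal (A : Type) (n : nat) (w : pword A) : Prop :=
  forall x : n.-tuple A, exists! i : nat, covers w i x.

(* Main.v *)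
Require Import Defs.
From mathcomp Require Import all_boot.
From mathcomp Require Import zify.

Set Implicit Arguments.
Unset Strict Implicit.
Unset Printing Implicit Defensive.

(** Write [w = u <>^k v], [s = |u|], [r = |v|], [N = s + k + r].  A window of
    length [n] ending in a diamond covers all right extensions [p c] of the
    words [p] of length [n - 1] that it starts with, so by uniqueness such a [p]
    can match [w] elsewhere only at its very end; dually for windows starting
    with a diamond.

    If [s >= n - k] and [r > 0], let [U] be the last [n - k] letters of [u]; a
    word [c U y] whose first letter differs from the letter of [u] before [U]
    and whose last letter differs from that of [v] is then not covered.  The
    case [r >= n - k], [s > 0] is the mirror image.

    If both [s] and [r] are smaller than [n - k], then all windows contain the
    position [N - n], which carries a letter, and a constant word on a different
    letter is not covered.

    There remains [w = <>^k v] up to reversal.  Looking for words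
    [y v_1 .. v_(n-k) z] forces [v] to start with [c^(n-k) d], [d <> c], and
    then a suitable word [y c^(n-k) d e] is not covered. *)

(** Words are functions on [nat] of which only the first [n] values matter, and
    partial words are functions of which only the first [N] values matter. *)
Definition fcovers (A : Type) (n N : nat) (W : nat -> option A) (i : nat)
    (x : nat -> A) : Prop :=
  i + n <= N /\ forall j c, j < n -> W (i + j) = Some c -> x j = c.

Definition funiversal (A : Type) (n N : nat) (W : nat -> option A) : Prop :=
  (forall x, exists i, fcovers n N W i x) /\
  (forall x i j, fcovers n N W i x -> fcovers n N W j x -> i = j).

(** The shape of [u <>^k v] without the lists, so that reversal is a mere change of index. *)
Definition one_gap (A : Type) (k s N : nat) (W : nat -> option A) : Prop :=
  [/\ s + k <= N, forall i, s <= i < s + k -> W i = None &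
      forall i, i < N -> (i < s) || (s + k <= i) -> exists c, W i = Some c].

Lemma funiversal_of_universal (A : Type) (n : nat) (w : pword A) :
  universal n w -> funiversal n (size w) (nth None w).
Proof.
have covE x i : fcovers n (size w) (nth None w) i x <->
    covers w i [tuple x j | j < n].
  split=> -[le_in cov]; split=> // j c.
    by rewrite tnth_mktuple; apply: cov.
  by move=> ltjn /(cov (Ordinal ltjn)); rewrite tnth_mktuple.
move=> univ; split=> [x | x i j /covE covi /covE covj].
  by have [i [/covE covi _]] := univ [tuple x j | j < n]; exists i.
have [l [_ uniq_l]] := univ [tuple x j | j < n].
by rewrite -(uniq_l i covi) -(uniq_l j covj).
Qed.

Lemma one_gap_word (A : Type) (k : nat) (u v : seq A) :
  one_gap k (size u) (size u + k + size v)
    (nth None (pword_of_word u ++ diamonds A k ++ pword_of_word v)).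
Proof.
split=> [|i lt_i|i lt_iN]; first exact: leq_addr.
  rewrite nth_cat size_map ltnNge (andP lt_i).1 /= nth_cat size_nseq.
  by rewrite ifT ?nth_nseq ?if_same //; lia.
have nthS (t : seq A) j : j < size t ->
    exists c, nth None (map Some t) j = Some c.
  case: t => // c0 t ltj; exists (nth c0 (c0 :: t) j).
  exact: (nth_map c0).
rewrite nth_cat size_map; case: ltnP => [lt_iu _ | le_ui]; first exact: nthS.
rewrite /= => le_i; rewrite nth_cat size_nseq ifF; last by lia.
by apply: nthS; lia.
Qed.

Lemma fcovers_rev (A : Type) (n N : nat) (W : nat -> option A) (i : nat)
    (x : nat -> A) :
  fcovers n N W i x ->
  fcovers n N (fun l => W (N.-1 - l)) (N - n - i) (fun l => x (n.-1 - l)).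
Proof.
move=> [le_iN cov]; split=> [|j c ltjn Wj]; first by lia.
by apply: cov; [lia | rewrite -Wj; congr (W _); lia].
Qed.

Lemma fcovers_revK (A : Type) (n N : nat) (W : nat -> option A) (i : nat)
    (x : nat -> A) :
  fcovers n N (fun l => W (N.-1 - l)) i x ->
  fcovers n N W (N - n - i) (fun l => x (n.-1 - l)).
Proof.
move=> /fcovers_rev [le_iN cov]; split=> // j c ltjn Wj.
by apply: cov => //; rewrite -Wj; congr (W _); lia.
Qed.

Lemma funiversal_rev (A : Type) (n N : nat) (W : nat -> option A) :
  funiversal n N W -> funiversal n N (fun l => W (N.-1 - l)).
Proof.
move=> [ex uniq]; split=> [x | x i j covi covj].
  have [i /fcovers_rev [le_iN cov]] := ex (fun l => x (n.-1 - l)).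
  exists (N - n - i); split=> // j c ltjn /(cov j c ltjn) <-.
  by congr (x _); lia.
have := uniq _ _ _ (fcovers_revK covi) (fcovers_revK covj).
by case: covi covj => + _ [+ _]; lia.
Qed.

Lemma one_gap_rev (A : Type) (k s N : nat) (W : nat -> option A) :
  0 < k -> one_gap k s N W -> one_gap k (N - s - k) N (fun l => W (N.-1 - l)).
Proof.
move=> k_gt0 [le_skN gap letters]; split=> [|i lt_i|i lt_i out].
- by lia.
- by apply: gap; lia.
- by apply: letters; lia.
Qed.

Lemma exists_other_letter (A : finType) (o : option A) :
  2 <= #|A| -> exists c, Some c <> o.
Proof.
move=> cardA; case: o => [a|]; last first.
  by have /card_gt0P [c _] : 0 < #|A| by [lia]; exists c.
have /card_gt0P [c] : 0 < #|predC1 a| by rewrite cardC1; lia.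
by rewrite inE => /eqP nca; exists c => -[].
Qed.

Section Universal.

Variables (A : finType) (n k s N : nat) (W : nat -> option A).
Hypotheses (cardA : 2 <= #|A|) (k_gt1 : 2 <= k) (le_2kn : 2 * k <= n).
Hypotheses (gapW : one_gap k s N W) (univW : funiversal n N W).

Lemma diamond_end_unique (i j : nat) (x : nat -> A) :
  fcovers n N W i x -> i + n < N -> j + n <= N -> W (j + n.-1) = None ->
  (forall q c, q < n.-1 -> W (j + q) = Some c -> x q.+1 = c) -> j = i.+1.
Proof.
move=> [_ cov] lt_iN le_jN Wj matchj.
(* Shift [x] and append the letter after window [i], or any letter at a diamond: windows [i.+1] and
   [j] both cover [x']. *)
pose x' q := if q < n.-1 then x q.+1 else odflt (x 0) (W (i + n)).
apply: (univW.2 x'); (split; first by lia) => q c ltqn Wq.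
- rewrite /x'; case: ifP => [ltq | geq]; first exact: matchj.
  by move: Wq; have -> : q = n.-1 by [lia]; rewrite Wj.
- rewrite /x'; case: ifP => [ltq | geq].
    by apply: cov; [lia | rewrite -Wq; congr (W _); lia].
  by have <- : i.+1 + q = i + n by [lia]; rewrite Wq.
Qed.

Lemma diamond_start_unique (i j : nat) (x : nat -> A) :
  fcovers n N W i x -> 0 < i -> j + n <= N -> W j = None ->
  (forall q c, q < n.-1 -> W (j + q.+1) = Some c -> x q = c) -> j = i.-1.
Proof.
move=> [le_iN cov] i_gt0 le_jN Wj matchj.
pose x' q := if q is q'.+1 then x q' else odflt (x 0) (W i.-1).
apply: (univW.2 x'); (split; first by lia) => -[|q] c ltqn Wq.
- by move: Wq; rewrite addn0 Wj.
- by apply: matchj => //; lia.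
- by move: Wq; rewrite addn0 /x' => ->.
- by apply: cov; [lia | rewrite -Wq; congr (W _); lia].
Qed.

Lemma long_prefix_absurd : n <= s + k -> s + k < N -> False.
Proof.
move=> le_nsk lt_skN; have [_ gap letters] := gapW.
pose j := s + k - n.
have [c0 c0P] := exists_other_letter (W j.-1) cardA.
have [z zP] := exists_other_letter (W N.-1) cardA.
pose x q := if q == 0 then c0 else if q == n.-1 then z
            else odflt c0 (W (j + q.-1)).
have [i [le_iN cov]] := univW.1 x.
have [lt_iN | ge_iN] := ltnP (i + n) N; last first.
  have [||d Wd] := letters N.-1; [by lia | by lia |].
  have : x n.-1 = d by apply: cov; [lia | rewrite -Wd; congr (W _); lia].
  by rewrite /x eqxx ifF; [move=> ezd; apply: zP; rewrite Wd ezd | lia].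
have ji : j = i.+1.
  apply: (@diamond_end_unique i j x) => //.
  - by rewrite /j; lia.
  - by apply: gap; rewrite /j; lia.
  (* The final [z] of [x] faces position [s + k - 2], a diamond because [k >= 2]. *)
  - move=> q c ltq Wq; rewrite /x /=; case: ifP => [eq_q | _].
      by move: Wq; rewrite gap // /j; lia.
    by rewrite Wq.
have [||d Wd] := letters i; [by lia | by rewrite /j in ji; lia |].
have : x 0 = d by apply: cov; [lia | rewrite addn0].
by rewrite /x /= => ecd; apply: c0P; rewrite ji /= Wd ecd.
Qed.

(** The last window starts at [N - n], inside the prefix by the first hypothesis; by the second,
    every window reaches that position. *)
Lemma short_sides_absurd : N < n + s -> s < n -> False.
Proof.
move=> lt_N lt_sn; have [_ _ letters] := gapW.
have [z zP] := exists_other_letter (W (N - n)) cardA.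
have [i [le_iN cov]] := univW.1 (fun=> z).
have [||d Wd] := letters (N - n); [by lia | by lia |].
apply: zP; rewrite Wd; congr Some.
by apply: (cov (N - n - i)); [lia | rewrite -Wd; congr (W _); lia].
Qed.

Lemma leading_gap_absurd : s = 0 -> False.
Proof.
move=> s0; have [_ gap letters] := gapW; rewrite s0 /= add0n in gap letters.
have [z zP] := exists_other_letter (W n) cardA.
have le_nN : n <= N by have [i [+ _]] := univW.1 (fun=> z); lia.
(* [y v_1 .. v_(n-k) z] is covered by the first window [<>^k v_1 .. v_(n-k)]. *)
have [step Wz] : (forall q, k <= q -> q < n.-1 -> W q = W q.+1) /\
                 W n.-1 = Some z.
  pose x q := if q == n.-1 then z else odflt z (W q.+1).
  have [i [le_iN cov]] := univW.1 x.
  (* Comparison with window 0 forces [i = 1] if [i > 0], but window 1 ends in [W n], which is not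
     [z]. *)
  have i0 : i = 0.
    case: (posnP i) => // i_gt0.
    have i1 : i = 1.
      suff : 0 = i.-1 by lia.
      apply: (diamond_start_unique (conj le_iN cov)) => //.
        by apply: gap; lia.
      by move=> q c ltq; rewrite add0n /x => ->; rewrite ifF //; lia.
    have [||d Wd] := letters n; [by lia | by lia |].
    have : x n.-1 = d by apply: cov; [lia | rewrite -Wd; congr (W _); lia].
    by rewrite /x eqxx => ezd; case: zP; rewrite Wd ezd.
  rewrite i0 in cov; split=> [q le_kq ltq|].
    have [||d Wd] := letters q; [by lia | by lia |].
    have [||d' Wd'] := letters q.+1; [by lia | by lia |].
    have : x q = d by apply: cov; [lia | rewrite add0n].
    by rewrite /x ifF ?Wd' ?Wd /=; [move=> -> | lia].
  have [||d Wd] := letters n.-1; [by lia | by lia |].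
  have : x n.-1 = d by apply: cov; [lia | rewrite add0n].
  by rewrite /x eqxx Wd => ->.
have Wc q : k <= q -> q < n -> W q = Some z.
  move=> le_kq ltq; have [m] := ubnP (n.-1 - q).
  elim: m q le_kq ltq => // m IHm q le_kq ltq lt_m.
  have [-> //|neq] := eqVneq q n.-1.
  by rewrite step; [apply: IHm | |]; lia.
(* [y z^(n-k) d e], where [d] follows [z^(n-k)] in [v] *)
have [e eP] := exists_other_letter (W n.+1) cardA.
(* If [W n] is no letter, any [d] other than [z] serves. *)
have [d dz dP] : exists2 d, d <> z & forall c, W n = Some c -> c = d.
  case WnE : (W n) zP => [d|] zP.
    by exists d => [edz|c [->]//]; rewrite edz in zP.
  have [d dP] := exists_other_letter (Some z) cardA.
  by exists d => // edz; rewrite edz in dP.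
pose x q := if q == n.-1 then e else if q == n.-2 then d else z.
have xn2 : x n.-2 = d by rewrite /x eqxx ifF //; lia.
have [i [le_iN cov]] := univW.1 x.
(* Windows 0 and 1 have [z] where [x] has [d], since positions [n.-2] and [n.-1] lie beyond the
   gap. *)
have [|i_gt1] := leqP i 1.
  move=> le_i1; apply: dz; rewrite -xn2; apply: cov; first by lia.
  by apply: Wc; lia.
(* Window 1 still starts with a diamond as [k >= 2], and its remainder matches the start of [x];
   window 2 is then excluded by [e]. *)
have i2 : i = 2.
  suff : 1 = i.-1 by lia.
  apply: (diamond_start_unique (conj le_iN cov)); [by lia | by lia | |].
    by apply: gap; lia.
  move=> q c ltq.
  rewrite /x ifF; last by lia.
  case: ifP => [/eqP -> | neq].
    by have -> : 1 + (n.-2).+1 = n by [lia]; move=> /dP ->.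
  have [lt_qk | le_kq] := ltnP (1 + q.+1) k; first by rewrite gap.
  by rewrite Wc //; [case | lia].
have [||f Wf] := letters n.+1; [by lia | by lia |].
have : x n.-1 = f by apply: cov; [lia | rewrite -Wf; congr (W _); lia].
by rewrite /x eqxx => ef; apply: eP; rewrite Wf ef.
Qed.

End Universal.

Theorem theorem3p4 (A : finType) (n k : nat) (hA : 2 <= #|A|) (hn : 0 < n)
    (hk : 2 <= k) (hkn : 2 * k <= n) :
  ~ exists u v : seq A,
      universal n (pword_of_word u ++ diamonds A k ++ pword_of_word v).
Proof.
move=> [u [v /funiversal_of_universal univ]].
have gap := one_gap_word k u v; move: univ gap.
rewrite !size_cat size_nseq !size_map addnA.
move: (nth _ _) (size u) (size v) => W s r univ gap.
have univ' := funiversal_rev univ.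
have gap' : one_gap k r (s + k + r) (fun l => W ((s + k + r).-1 - l)).
  have := one_gap_rev (ltnW hk) gap.
  by have -> : s + k + r - s - k = r by lia.
have [s0|s_gt0] := posnP s; first exact: leading_gap_absurd gap univ s0.
have [r0|r_gt0] := posnP r; first exact: leading_gap_absurd gap' univ' r0.
have [le_n|lt_n] := leqP n (s + k).
  by apply: long_prefix_absurd gap univ le_n _; lia.
have [le_n'|lt_n'] := leqP n (r + k).
  by apply: long_prefix_absurd gap' univ' le_n' _; lia.
by apply: short_sides_absurd gap univ _ _; lia.
Qed.
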